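(* Let $a\ge 2$ be an integer not divisible by $3$ and let $S=\langle a,a+3\rangle$. Then, with $b$ denoting a non-negative integer satisfying the relevant condition, the largest perfect square ${}^{2}r(S)$ not belonging to $S$ is given by $$ {}^{2}r(S)=\begin{cases} (a-(3b-1))^2 & \text{if either } (3b+1)^2\le a+3<(3b+2)^2 \text{ and } a\equiv 1 \pmod 3,\\ & \text{or } (3b+1)^2\le 2(a+3)<(3b+2)^2 \text{ and } a\equiv 2 \pmod 3;\\[1ex] (a-(3b+1))^2 & \text{if either } (3b+2)^2\le a+3<(3b+4)^2 \text{ and } a\equiv 1 \pmod 3,\\ & \text{or } (3b+2)^2\le 2(a+3)<(3b+4)^2 \text{ and } a\equiv 2 \pmod 3. \end{cases} $$
   Context: $\langle s_1,s_2\rangle=\{x_1s_1+x_2s_2 : x_1,x_2 \text{ integers},\ x_1,x_2\ge 0\}$. For a numerical semigroup $S$ with $1\notin S$ (generated by relatively prime positive integers), ${}^{2}r(S)$ denotes the largest perfect square $m^2$ ($m\ge 1$ an integer) not belonging to $S$. *)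

(* Defs.v *)
From Stdlib Require Import ZArith Lia.
Open Scope Z_scope.

Definition generated (s1 s2 n : Z) : Prop :=
  exists x1 x2 : Z, 0 <= x1 /\ 0 <= x2 /\ n = x1 * s1 + x2 * s2.

(* The graph of [S |-> 2r(S)].  It is a relation because the largest square
   outside [S] exists only for suitable [S]; asserting
   [largest_square_outside S r] includes its existence. *)
Definition largest_square_outside (S : Z -> Prop) (r : Z) : Prop :=
  (exists m : Z, 1 <= m /\ r = m ^ 2) /\
  ~ S r /\
  (forall m : Z, 1 <= m -> ~ S (m ^ 2) -> m ^ 2 <= r).

Lemma largest_square_outside_unique (S : Z -> Prop) (r r' : Z) :
  largest_square_outside S r -> largest_square_outside S r' -> r = r'.
Proof.
  intros [[m [Hm ->]] [Hr Hmax]] [[m' [Hm' ->]] [Hr' Hmax']].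
  specialize (Hmax m' Hm' Hr'). specialize (Hmax' m Hm Hr). lia.
Qed.

Definition first_case (a b : Z) : Prop :=
  ((3 * b + 1) ^ 2 <= a + 3 < (3 * b + 2) ^ 2 /\ a mod 3 = 1) \/
  ((3 * b + 1) ^ 2 <= 2 * (a + 3) < (3 * b + 2) ^ 2 /\ a mod 3 = 2).

Definition second_case (a b : Z) : Prop :=
  ((3 * b + 2) ^ 2 <= a + 3 < (3 * b + 4) ^ 2 /\ a mod 3 = 1) \/
  ((3 * b + 2) ^ 2 <= 2 * (a + 3) < (3 * b + 4) ^ 2 /\ a mod 3 = 2).

(* Main.v *)
Require Import Defs.
From Stdlib Require Import ZArith Znumtheory Lia.
Open Scope Z_scope.

(** Grouping the generators, [S = <a, a+3>] consists of the numbers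
    [k a + 3 j] with [0 <= j <= k].  Squares are measured from [a ^ 2]: since
    [(a - c)^2 = (a - 2c) a + c^2], choosing [e] in [{0, 1, 2}] with
    [3 | c^2 + e a] gives the representation [k = a - 2c - e],
    [3 j = c^2 + e a], and the requirement [j <= k] becomes

      [(c + 3)^2 <= (3 - e) (a + 3)].

    Because [3] and [a] are coprime, all other representations come from this
    one by moving multiples of [3 a] between the two terms, so as long as
    [0 <= j < a] the displayed inequality decides membership
    ([square_below_generated] and [square_below_not_generated]).

    If [3 | c] then [e = 0], and otherwise [e = 2] or [e = 1] according to
    [a mod 3 = 1] or [2]; then [(3 - e) (a + 3)] is the [a + 3] or
    [2 (a + 3)] of the theorem.  Multiples of [3] are under the weaker bound
    [3 (a + 3)], which makes their squares members throughout the relevant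
    range, and the squares of [a + d] with [d > 0] exceed the Frobenius number.
    Hence the largest missing square is [(a - c)^2] for the least [c >= 1]
    prime to [3] with [(c + 3)^2 > (3 - e) (a + 3)]
    ([largest_square_outside_of_least_offset]).  The two cases of the theorem
    correspond to the two residues of that [c]: [c = 3 b - 1] or
    [c = 3 b + 1]. *)

Lemma generated_iff (a n : Z) :
  generated a (a + 3) n <->
  exists k j : Z, 0 <= j <= k /\ n = k * a + 3 * j.
Proof.
  split.
  - intros (x1 & x2 & H1 & H2 & ->). exists (x1 + x2), x2. split; [lia | ring].
  - intros (k & j & H & ->). exists (k - j), j. split; [lia | split; [lia | ring]].
Qed.

Lemma square_below_generated (a c e : Z) :
  0 <= a -> 0 <= e -> (3 | c ^ 2 + e * a) ->
  (c + 3) ^ 2 <= (3 - e) * (a + 3) ->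
  generated a (a + 3) ((a - c) ^ 2).
Proof.
  intros Ha He [j Hj] Hle. apply generated_iff.
  exists (a - 2 * c - e), j. nia.
Qed.

(** The bound [c^2 < (3 - e) a] says that the index [j] of the representation
    [3 j = c^2 + e a] is below [a]; so [j] cannot be lowered by [a], and
    raising it by multiples of [a] only lowers [k]. *)
Lemma square_below_not_generated (a c e : Z) :
  0 < a -> ~ (3 | a) -> (3 | c ^ 2 + e * a) ->
  c ^ 2 < (3 - e) * a ->
  (3 - e) * (a + 3) < (c + 3) ^ 2 ->
  ~ generated a (a + 3) ((a - c) ^ 2).
Proof.
  intros Ha Hn3 [j0 Hj0] Hsmall Hgt.
  rewrite generated_iff. intros (k & j & Hjk & Heq).
  assert (Hshift : a * (k - (a - 2 * c - e)) = 3 * (j0 - j)) by nia.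
  assert (H3 : (3 | k - (a - 2 * c - e))).
  { apply Gauss with a.
    - exists (j0 - j). lia.
    - apply prime_rel_prime; [exact prime_3 | exact Hn3]. }
  destruct H3 as [t Ht].
  assert (Hj : j = j0 - t * a) by nia.
  assert (Ht0 : t <= 0).
  { assert (j0 < a) by lia. assert (0 <= j) by lia.
    clear Hshift Heq Hsmall Hgt Hj0 Ht. nia. }
  assert (t * (a + 3) <= 0) by (clear - Ht0 Ha; nia).
  lia.
Qed.

(** Take [j < a] with [3 j = n] modulo [a]; the remaining multiple [k] of [a]
    is large enough because [n >= j (a + 3)]. *)
Lemma generated_of_large (a n : Z) :
  0 < a -> ~ (3 | a) -> (a - 1) * (a + 3) <= n ->
  generated a (a + 3) n.
Proof.
  intros Ha Hn3 Hn.
  assert (Hcop : rel_prime 3 a)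
    by (apply prime_rel_prime; [exact prime_3 | exact Hn3]).
  destruct (rel_prime_bezout _ _ Hcop) as [u v Huv].
  pose proof (Z.div_mod (u * n) a ltac:(lia)) as Hdiv.
  pose proof (Z.mod_pos_bound (u * n) a Ha) as Hmod.
  set (q := u * n / a) in *. set (j := (u * n) mod a) in *.
  apply generated_iff. exists (v * n + 3 * q), j.
  assert (Heq : n = (v * n + 3 * q) * a + 3 * j).
  { transitivity ((u * 3 + v * a) * n); [rewrite Huv; ring |].
    transitivity (3 * (u * n) + v * n * a); [ring |].
    rewrite Hdiv. ring. }
  split; [| exact Heq].
  split; [lia |].
  generalize dependent (v * n + 3 * q). intros k Heq. nia.
Qed.

Lemma not_divide_3_residue (x : Z) :
  ~ (3 | x) -> x mod 3 = 1 \/ x mod 3 = 2.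
Proof.
  intros Hx. pose proof (Z.mod_pos_bound x 3 ltac:(lia)).
  assert (x mod 3 <> 0) by (intro H0; apply Hx, Z.mod_divide; lia). lia.
Qed.

Lemma three_divides_square_plus_multiple (a c e : Z) :
  a mod 3 = 1 /\ e = 2 \/ a mod 3 = 2 /\ e = 1 -> ~ (3 | c) ->
  (3 | c ^ 2 + e * a).
Proof.
  intros Hae Hc.
  pose proof (not_divide_3_residue c Hc) as Hc'.
  pose proof (Z.div_mod a 3 ltac:(lia)) as Ha3.
  pose proof (Z.div_mod c 3 ltac:(lia)) as Hc3.
  set (q := a / 3) in *. set (p := c / 3) in *. clearbody q p.
  destruct Hae as [[Ha He] | [Ha He]]; destruct Hc' as [Hc' | Hc'];
    rewrite Ha in Ha3; rewrite Hc' in Hc3; subst a c e.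
  - exists (3 * p * p + 2 * p + 2 * q + 1). ring.
  - exists (3 * p * p + 4 * p + 2 * q + 2). ring.
  - exists (3 * p * p + 2 * p + q + 1). ring.
  - exists (3 * p * p + 4 * p + q + 2). ring.
Qed.

(** Only offsets prime to [3] have to be tested.  If [3 | d], [0 < d < c],
    the test for [d - 1] gives [(d + 2)^2 <= 2 (a + 3)], and
    [(d + 3)^2 <= (3/2) (d + 2)^2] as soon as [d >= 3], so that
    [(d + 3)^2 <= 3 (a + 3)]. *)
Lemma largest_square_outside_of_least_offset (a c e : Z) :
  0 < a -> a mod 3 = 1 /\ e = 2 \/ a mod 3 = 2 /\ e = 1 ->
  c < a -> ~ (3 | c) -> c ^ 2 < (3 - e) * a ->
  (3 - e) * (a + 3) < (c + 3) ^ 2 ->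
  (forall d, 1 <= d < c -> ~ (3 | d) -> (d + 3) ^ 2 <= (3 - e) * (a + 3)) ->
  largest_square_outside (generated a (a + 3)) ((a - c) ^ 2).
Proof.
  intros Ha Hae Hca Hc Hsmall Hgt Hleast.
  assert (Hn3 : ~ (3 | a)).
  { intros H. apply Z.mod_divide in H; lia. }
  split; [exists (a - c); split; [lia | reflexivity] |].
  split.
  { apply square_below_not_generated with e; auto.
    apply three_divides_square_plus_multiple; assumption. }
  intros m Hm HnS.
  destruct (Z_le_gt_dec m (a - c)) as [Hle | Hmc]; [nia |].
  exfalso. apply HnS.
  destruct (Z_lt_le_dec a m) as [Hbig | Hma].
  { apply generated_of_large; [lia | exact Hn3 |].
    clear - Ha Hbig. nia. }
  replace m with (a - (a - m)) by ring.
  assert (Hd : 0 <= a - m < c) by lia.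
  set (d := a - m) in *. clearbody d.
  destruct (Zdivide_dec 3 d) as [H3 | H3].
  - apply square_below_generated with 0; try lia.
    + destruct H3 as [q ->]. exists (3 * q * q). ring.
    + destruct (Z.eq_dec d 0) as [-> | Hd0]; [lia |].
      destruct H3 as [q Hq].
      assert (Hpred : (d - 1 + 3) ^ 2 <= (3 - e) * (a + 3)).
      { apply Hleast; [lia |]. intros [p Hp]. lia. }
      assert (Hd3 : 3 <= d) by lia.
      assert (Hdouble : (d - 1 + 3) ^ 2 <= 2 * (a + 3)).
      { assert (He : 3 - e <= 2) by lia. clear - Ha Hpred He. nia. }
      clear - Hdouble Hd3. nia.
  - apply square_below_generated with e; try lia.
    + apply three_divides_square_plus_multiple; assumption.
    + apply Hleast; [| assumption].
      assert (d <> 0) by (intros ->; apply H3; exists 0; reflexivity). lia.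
Qed.

Lemma square_interval_cases (n : Z) :
  1 <= n ->
  exists b, 0 <= b /\
    ((3 * b + 1) ^ 2 <= n < (3 * b + 2) ^ 2 \/
     (3 * b + 2) ^ 2 <= n < (3 * b + 4) ^ 2).
Proof.
  intros Hn.
  pose proof (Z.sqrt_spec n ltac:(lia)) as Hs.
  pose proof (Z.sqrt_nonneg n) as Hs0.
  set (s := Z.sqrt n) in *. clearbody s.
  assert (1 <= s) by (destruct (Z.eq_dec s 0) as [-> |]; simpl in Hs; lia).
  pose proof (Z.div_mod (s - 1) 3 ltac:(lia)) as Hdiv.
  pose proof (Z.mod_pos_bound (s - 1) 3 ltac:(lia)) as Hmod.
  exists ((s - 1) / 3). split; [apply Z.div_pos; lia |].
  set (b := (s - 1) / 3) in *. clearbody b.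
  destruct (Z.eq_dec ((s - 1) mod 3) 0) as [H0 | H0]; [left | right].
  - replace s with (3 * b + 1) in Hs by lia. unfold Z.succ in Hs. nia.
  - assert (3 * b + 2 <= s <= 3 * b + 3) by lia. unfold Z.succ in Hs. nia.
Qed.

Theorem theorem3p1 :
  forall a : Z, 2 <= a -> ~ (3 | a) ->
    (exists b : Z, 0 <= b /\ (first_case a b \/ second_case a b)) /\
    (forall b : Z, 0 <= b ->
      (first_case a b ->
         largest_square_outside (generated a (a + 3)) ((a - (3 * b - 1)) ^ 2)) /\
      (second_case a b ->
         largest_square_outside (generated a (a + 3)) ((a - (3 * b + 1)) ^ 2))).
Proof.
  intros a Ha Hn3. split.
  - pose proof (not_divide_3_residue a Hn3) as Hmod.
    unfold first_case, second_case.
    destruct Hmod as [Hmod | Hmod].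
    + destruct (square_interval_cases (a + 3)) as (b & Hb & H); [lia |].
      exists b. tauto.
    + destruct (square_interval_cases (2 * (a + 3))) as (b & Hb & H); [lia |].
      exists b. tauto.
  - intros b Hb. split; intros Hcase.
    + assert (He : exists e, (a mod 3 = 1 /\ e = 2 \/ a mod 3 = 2 /\ e = 1) /\
                (3 * b + 1) ^ 2 <= (3 - e) * (a + 3) < (3 * b + 2) ^ 2).
      { destruct Hcase as [[H Hm] | [H Hm]]; [exists 2 | exists 1];
          (split; [tauto | lia]). }
      destruct He as (e & Hae & Hlo & Hhi).
      assert (He : 1 <= 3 - e <= 2) by lia.
      (* For [b = 0] the upper bound is [4], below [a + 3]. *)
      assert (Hb1 : 1 <= b) by nia.
      apply largest_square_outside_of_least_offset with e; try assumption.
      * lia.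
      * nia.
      * intros [p Hp]. lia.
      * nia.
      * nia.
      * intros d Hd Hd3. nia.
    + assert (He : exists e, (a mod 3 = 1 /\ e = 2 \/ a mod 3 = 2 /\ e = 1) /\
                (3 * b + 2) ^ 2 <= (3 - e) * (a + 3) < (3 * b + 4) ^ 2).
      { destruct Hcase as [[H Hm] | [H Hm]]; [exists 2 | exists 1];
          (split; [tauto | lia]). }
      destruct He as (e & Hae & Hlo & Hhi).
      assert (He : 1 <= 3 - e <= 2) by lia.
      apply largest_square_outside_of_least_offset with e; try assumption.
      * lia.
      * nia.
      * intros [p Hp]. lia.
      * destruct (Z.eq_dec b 0) as [-> | Hb0]; nia.
      * nia.
      * intros d Hd Hd3.
        (* [d = 3 b] is excluded, so [d + 3 <= 3 b + 2]. *)
        assert (d <> 3 * b) by (intros ->; apply Hd3; exists b; ring).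
        nia.
Qed.
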